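(* For every integer $k\ge 2$ we have $\Xi(k)\le 2k-2$. Moreover, $\lim_{k\to\infty}\frac{\Xi(k)}{k}=2$.
   Context: All graphs are finite, simple and undirected (no loops, no multiple edges). For a graph $G=(V,E)$ and $x\in V$, $N[x]=\{x\}\cup\{y\in V: xy\in E\}$ is the closed neighbourhood of $x$. A set $C\subseteq V$ is called identifying if for all distinct $X,Y\subseteq V$ with $|X|,|Y|\le 1$ we have $N[X]\cap C\ne N[Y]\cap C$, where $N[X]=\bigcup_{x\in X}N[x]$ (so $N[\emptyset]=\emptyset$); equivalently, $N[x]\cap C\neq\emptyset$ for every $x\in V$ and $N[x]\cap C\ne N[y]\cap C$ for all distinct $x,y\in V$. For integers $n\ge k\ge 1$, $\mathfrak{Gr}(n,k)$ denotes the set of graphs on $n$ vertices in which every $k$-element subset of vertices is identifying. $\Xi(k)=\max\{n\ge k:\mathfrak{Gr}(n,k)\neq\emptyset\}$. *)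

(* Defs.v *)
From HB Require Import structures.
From mathcomp Require Import all_boot all_order all_algebra.
From mathcomp Require Import all_classical all_reals all_analysis.
Set Implicit Arguments.
Unset Strict Implicit.
Unset Printing Implicit Defensive.
Import Order.TTheory GRing.Theory Num.Theory.
Import numFieldNormedType.Exports.

Record sgraph := SGraph {
  vertex :> finType;
  adj : rel vertex;
  adj_sym : symmetric adj;
  adj_irr : irreflexive adj }.

Definition closed_nbh (G : sgraph) (x : G) : {set G} :=
  x |: [set y | adj x y]%SET.

Definition closed_nbhs (G : sgraph) (X : {set G}) : {set G} :=
  (\bigcup_(x in X) closed_nbh x)%SET.

Definition identifying (G : sgraph) (C : {set G}) : Prop :=
  forall X Y : {set G}, #|X| <= 1 -> #|Y| <= 1 -> X <> Y ->
    (closed_nbhs X :&: C)%SET <> (closed_nbhs Y :&: C)%SET.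

(* A predicate rather than a [set sgraph]: the type of all finite graphs is too
   large for the universe of [set]. *)
Definition Gr (n k : nat) (G : sgraph) : Prop :=
  #|G| = n /\ forall C : {set G}, #|C| = k -> identifying C.

Lemma closed_nbhs1 (G : sgraph) (x : G) : closed_nbhs [set x]%SET = closed_nbh x.
Proof. by rewrite /closed_nbhs big_set1. Qed.

Lemma Gr_diag (k : nat) : exists G, Gr k k G.
Proof.
have sym0 : symmetric (fun _ _ : 'I_k => false) by [].
have irr0 : irreflexive (fun _ : 'I_k => xpred0 : pred 'I_k) by [].
exists (SGraph sym0 irr0); split => /=; first exact: card_ord.
move=> C cardC X Y _ _ neqXY.
have -> : C = [set: 'I_k]%SET.
  by apply/eqP; rewrite eqEcard finset.subsetT cardsT /= card_ord cardC leqnn.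
have nbhsE (Z : {set 'I_k}) : closed_nbhs (G := SGraph sym0 irr0) Z = Z.
  apply/setP => z; apply/bigcupP/idP => [[x xZ]|zZ].
    by rewrite !inE orbF => /eqP ->.
  by exists z => //; rewrite !inE eqxx.
by rewrite !finset.setIT !nbhsE.
Qed.

Lemma Gr_bound (n k : nat) : k <= n -> (exists G, Gr n k G) -> n <= 2 ^ k.
Proof.
move=> le_kn [G [cardG idG]].
have [C _ cardC] : exists2 C : {set G}, C \subset [set: G]%SET & #|C| = k.
  have := @cards_draws G [set: G]%SET k; rewrite cardsT cardG.
  have : 0 < 'C(n, k) by rewrite bin_gt0.
  by move=> h e; move: h; rewrite -e => /card_gt0P[C]; rewrite inE => /andP[? /eqP];
    exists C.
rewrite -cardC -card_powerset -cardG -cardsT.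
rewrite -(card_imset (f := fun x : G => closed_nbh x :&: C)%SET).
  apply/subset_leq_card/fintype.subsetP => A /imsetP[x _ ->].
  by rewrite powersetE finset.subsetIr.
move=> x y exy; apply/eqP/negPn/negP => /eqP neqxy.
apply: (idG C cardC [set x]%SET [set y]%SET); rewrite ?cards1 // ?closed_nbhs1 //.
by move/finset.set1_inj.
Qed.

Lemma Xi_ex (k : nat) :
  exists n, (k <= n) && `[< exists G, Gr n k G >].
Proof. by exists k; rewrite leqnn; apply/asboolP/Gr_diag. Qed.

Lemma Xi_ub (k n : nat) :
  (k <= n) && `[< exists G, Gr n k G >] -> n <= 2 ^ k.
Proof. by case/andP=> le_kn /asboolP; apply: Gr_bound. Qed.

(* The largest n >= k with some graph in Gr n k; [Xi_ub] is only the crude bound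
   showing that this maximum exists. *)
Definition Xi (k : nat) : nat := ex_maxn (Xi_ex k) (@Xi_ub k).

(* Main.v *)
(* Append the empty word to the n closed neighbourhoods and view them as n + 1
   binary words of length n: every k-subset is identifying iff their pairwise
   Hamming distances exceed n - k.

   Upper bound: the Plotkin double count gives n <= 2k - 1.  If n = 2k - 1 it is
   tight, so every closed neighbourhood has k elements and every distance is k;
   hence k is even, and G would be a (k - 1)-regular graph of odd degree on an odd
   number of vertices.

   Asymptotics: let F be a field of order q = 2^j with a nontrivial additive
   character lam : F -> {0, 1}, and let S be a set of t nonzero elements of F.
   Join (a, x) and (b, y) in S x F when lam(xy + ab(x + y)) = 1.  Two neighbourhood
   words differ on the block {b} x F by lam of an affine map in y, whose slope
   vanishes for at most one b; every other block is balanced.  So two words agree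
   on at most (t + 1) q / 2 + 2 of the t q vertices; taking q of order sqrt k and
   t close to 2k / q gives Xi k >= 2k - O(sqrt k). *)

Require Import Defs.
From mathcomp Require Import all_boot all_order all_algebra.
From mathcomp Require Import all_classical all_reals all_analysis.
From mathcomp Require Import all_field.
From mathcomp Require Import zify ring.
Set Implicit Arguments.
Unset Strict Implicit.
Unset Printing Implicit Defensive.
Import Order.TTheory GRing.Theory Num.Theory.
Import numFieldNormedType.Exports.
Local Open Scope nat_scope.

(** * Hamming distances, and [Gr] in terms of words *)

Definition hamming (V : finType) (A B : {set V}) : nat :=
  #|[set z | (z \in A) (+) (z \in B)]%SET|.

Lemma hamming_sum (V : finType) (A B : {set V}) :
  hamming A B = \sum_z ((z \in A) (+) (z \in B)).
Proof.
rewrite /hamming -sum1_card big_mkcond; apply: eq_bigr => z _.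
by rewrite inE; case: (_ (+) _).
Qed.

(** Double counting: coordinate [z] separates an ordered pair exactly when one of its two words
    contains [z]. *)
Lemma sum_hamming (T V : finType) (c : T -> {set V}) (w : V -> nat) :
  (forall z, w z = #|[set u | z \in c u]%SET|) ->
  \sum_u \sum_v hamming (c u) (c v) = \sum_z 2 * (w z * (#|T| - w z)).
Proof.
move=> wE; under eq_bigr do under eq_bigr do rewrite hamming_sum.
under eq_bigr do rewrite exchange_big /=.
rewrite exchange_big /=; apply: eq_bigr => z _.
rewrite wE; set P := [set u | z \in c u]%SET.
have inP v : (z \in c v) = (v \in P) by rewrite /P inE.
have sumP (Q : {set T}) : \sum_v (v \in Q) = #|Q|.
  by rewrite -sum1_card [RHS]big_mkcond; apply: eq_bigr => v _ /=; case: (v \in Q).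
have rowE u : \sum_v ((z \in c u) (+) (z \in c v)) =
    (u \in P) * #|~: P|%SET + (u \in ~: P)%SET * #|P|.
  rewrite inP finset.in_setC; case: (u \in P).
    rewrite /= mul0n mul1n addn0 -sumP. apply: eq_bigr => v _.
    by rewrite inP finset.in_setC.
  by rewrite mul0n add0n mul1n -sumP; apply: eq_bigr => v _; rewrite inP.
under eq_bigr do rewrite rowE.
rewrite big_split -!big_distrl /= !sumP -(cardsC P) addKn; lia.
Qed.

Lemma hammingxx (V : finType) (A : {set V}) : hamming A A = 0.
Proof. by apply: eq_card0 => z; rewrite !inE addbb. Qed.

Lemma hamming_card (V : finType) (A B : {set V}) :
  hamming A B + 2 * #|A :&: B|%SET = #|A| + #|B|.
Proof.
have -> : hamming A B = #|A :\: B|%SET + #|B :\: A|%SET.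
  rewrite -cardsUI (_ : (A :\: B) :&: (B :\: A) = finset.set0)%SET ?cards0 ?addn0.
    by apply: eq_card => z; rewrite !inE; do 2!case: (z \in _).
  by apply/setP => z; rewrite !inE; do 2!case: (z \in _).
rewrite -(cardsID B A) -(cardsID A B) (finset.setIC B A); lia.
Qed.

(* [None] stands for the empty vertex set. *)
Definition word (G : sgraph) (u : option G) : {set G} :=
  if u is Some x then closed_nbh x else finset.set0.

Lemma hammingE (V : finType) (A B : {set V}) :
  hamming A B = #|V| - #|[set z | (z \in A) == (z \in B)]%SET|.
Proof.
rewrite -(cardsC [set z | (z \in A) == (z \in B)]%SET) addKn.
by apply: eq_card => z; rewrite !inE -addNb negbK; do 2!case: (z \in _).
Qed.

(** Two words look alike on [C] iff [C] lies in their agreement set, so a bad [k]-subset exists iff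
    that set has at least [k] elements. *)
Lemma Gr_word (n k : nat) (G : sgraph) : k <= n ->
  Gr n k G <-> #|G| = n /\
    forall u v : option G, u != v -> n - k < hamming (word u) (word v).
Proof.
move=> le_kn.
pose toset (u : option G) : {set G} :=
  if u is Some x then [set x]%SET else finset.set0.
have nbhs_toset u : closed_nbhs (toset u) = word u.
  by case: u => [x|]; rewrite /= ?closed_nbhs1 // /closed_nbhs big_set0.
have toset_inj : injective toset.
  move=> [x|] [y|] //=; first by move/finset.set1_inj ->.
    by move/setP/(_ x); rewrite !inE eqxx.
  by move/setP/(_ y); rewrite !inE eqxx.
have toset_le1 u : #|toset u| <= 1 by case: u => [x|]; rewrite /= ?cards1 ?cards0.
have toset_surj (X : {set G}) : #|X| <= 1 -> exists u, X = toset u.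
  rewrite leq_eqVlt ltnS leqn0 cards_eq0 => /orP[/cards1P[x ->]|/eqP->].
    by exists (Some x).
  by exists None.
split=> -[cardG idG]; split=> //.
- move=> u v neq_uv; rewrite hammingE cardG.
  set A := finset _; rewrite ltnNge; apply/negP => leA.
  have le_kA : k <= #|A| by have := max_card (mem A); rewrite cardG; lia.
  have [C sCA cardC] : exists2 C : {set G}, C \subset A & #|C| = k.
    have : 0 < #|[set C : {set G} | (C \subset A) && (#|C| == k)]%SET|.
      by rewrite cards_draws bin_gt0.
    by case/card_gt0P=> C; rewrite inE => /andP[sCA /eqP cardC]; exists C.
  apply: (idG C cardC (toset u) (toset v)) => //.
    by move/toset_inj/eqP; apply/negP.
  rewrite !nbhs_toset; apply/setP => z; rewrite !inE.
  have [zC|] := boolP (z \in C); last by rewrite !andbF.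
  by have := fintype.subsetP sCA z zC; rewrite !inE !andbT => /eqP.
- move=> C cardC X Y /toset_surj[u ->] /toset_surj[v ->] neqXY eqC.
  have /idG : u != v by apply/eqP => uv; apply: neqXY; rewrite uv.
  rewrite hammingE cardG; set A := finset _ => ltA.
  have : #|C| <= #|A|.
    apply/subset_leq_card/fintype.subsetP => z zC; rewrite inE.
    by move/setP/(_ z): eqC; rewrite !nbhs_toset !inE zC !andbT => ->.
  rewrite cardC; lia.
Qed.

(** * Upper bound by the Plotkin count *)

Lemma words_containing (G : sgraph) (z : G) :
  [set u | z \in word u]%SET = [set Some x | x in closed_nbh z]%SET.
Proof.
apply/setP => u; rewrite inE; apply/idP/imsetP => [|[x xz ->]]; last first.
  by move: xz; rewrite !inE adj_sym eq_sym.
case: u => [x|]; rewrite /= ?inE // => xz; exists x => //.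
by rewrite !inE eq_sym adj_sym.
Qed.

(** Split ordered pairs by the order of their ranks; swapping the endpoints exchanges the two
    halves. *)
Lemma handshake (G : sgraph) : ~~ odd (\sum_(x : G) \sum_(y : G) adj x y).
Proof.
pose r (x : G) : nat := enum_rank x.
have E : \sum_(x : G) \sum_(y : G) adj x y =
    \sum_(x : G) \sum_(y : G) (adj x y && (r x < r y)) +
    \sum_(x : G) \sum_(y : G) (adj x y && (r y < r x)).
  rewrite -big_split; apply: eq_bigr => x _ /=.
  rewrite -big_split; apply: eq_bigr => y _ /=.
  case: (ltngtP (r x) (r y)) => [||/ord_inj/enum_rank_inj->]; rewrite ?andbT ?andbF ?addn0 //.
  by rewrite adj_irr.
rewrite E [X in _ + X]exchange_big /=.
under [X in _ + X]eq_bigr do under eq_bigr do rewrite adj_sym.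
by rewrite addnn odd_double.
Qed.

Lemma card_closed_nbh (G : sgraph) (x : G) :
  #|closed_nbh x| = (\sum_(y : G) adj x y).+1.
Proof.
rewrite cardsU1 inE adj_irr /= add1n -sum1_card big_mkcond /=.
by congr _.+1; apply: eq_bigr => y _; rewrite inE; case: adj.
Qed.

Lemma Gr_le (n k : nat) (G : sgraph) : 2 <= k -> k <= n -> Gr n k G -> n <= 2 * k - 2.
Proof.
move=> k2 le_kn /(Gr_word _ le_kn)[cardG dG].
set d := (n - k).+1 in dG.
pose w (z : G) := #|closed_nbh z|.
have wE z : w z = #|[set u | z \in word u]%SET|.
  by rewrite words_containing card_imset // => x y [].
have wle z : w z <= n by rewrite -cardG max_card.
have := sum_hamming wE; rewrite card_option cardG => sumE.
(* AM-GM at each vertex z: w z of the n + 1 words contain z. *)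
have up z : true -> 4 * (w z * (n.+1 - w z)) <= n.+1 ^ 2 ?= iff (w z == n.+1 - w z).
  by move=> _; have := nat_AGM2 (w z) (n.+1 - w z); rewrite subnKC // ltnW // ltnS.
(* The equality cases are carried along through [leqif] for the extremal case below. *)
have lo (u : option G) : true -> n * d <= \sum_v hamming (word u) (word v) ?= iff
     [forall (v | v != u), d == hamming (word u) (word v)].
  move=> _; rewrite (bigD1 u) //= hammingxx add0n.
  have -> : n * d = \sum_(v | v != u) d.
    rewrite sum_nat_const; congr (_ * _).
    transitivity #|predC1 u|; first by rewrite cardC1 card_option cardG.
    exact: eq_card.
  by apply: leqif_sum => v neq_vu; apply/leqif_eq/dG; rewrite eq_sym.
have [lo_le lo_eq] := leqif_sum lo; have [up_le up_eq] := leqif_sum up.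
move: lo_le lo_eq up_le up_eq.
have -> : \sum_z 4 * (w z * (n.+1 - w z)) = 2 * \sum_z 2 * (w z * (n.+1 - w z)).
  by rewrite big_distrr; apply: eq_bigr => z _ /=; lia.
rewrite !sum_nat_const -sumE card_option cardG.
set S := \sum_u _ => lo_le lo_eq up_le up_eq.
have le_d : 2 * d <= n.+1.
  have : (n.+1 * n) * (2 * d) <= (n.+1 * n) * n.+1 by nia.
  by rewrite leq_pmul2l //; lia.
(* Only [n = 2 * k - 1] survives [le_d]; then [2 * d = n.+1] and both estimates of [S] are
   equalities. *)
have [lt_n|] := leqP n (2 * k - 2) => // gt_n; exfalso.
have nE : n = 2 * k - 1 by lia.
have dE : d = k by lia.
have SE : S = n.+1 * (n * d) by nia.
have /forallP reg : [forall (z | true), w z == n.+1 - w z].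
  by rewrite -up_eq SE; apply/eqP; nia.
have wk z : w z = k by have /= /eqP := reg z; have := wle z; lia.
have /forallP equi :
    [forall (u : option G | true), forall (v | v != u), d == hamming (word u) (word v)].
  by rewrite -lo_eq SE.
have [x [y neq_xy]] : exists x y : G, x != y.
  have : 1 < #|G| by lia.
  by case/card_gt1P => x [y [_ _ neq_xy]]; exists x, y.
have /forallP/(_ (Some y))/= := equi (Some x).
rewrite eq_sym (inj_eq Some_inj) neq_xy /= => /eqP dxy.
(* Here [k + 2 * #|A :&: B| = k + k] for the two neighbourhoods, so [k] is even; the degree sum
   [(2 * k - 1) * (k - 1)] is then odd. *)
have := hamming_card (closed_nbh x) (closed_nbh y).
rewrite -dxy -/(w x) -/(w y) !wk dE => kE.
have := handshake G.
have -> : \sum_(x : G) \sum_(y : G) adj x y = n * k.-1.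
  rewrite -cardG -sum_nat_const; apply: eq_bigr => z _.
  by rewrite -(wk z) /w card_closed_nbh.
lia.
Qed.

(** * Additive characters in characteristic 2 *)

(** Over the prime field, some coordinate of 1 in a basis is nonzero; that coordinate is additive
    and serves as [lam]. *)
Lemma exists_pchar2_character (F : finFieldType) : 2 \in [pchar F]%R ->
  exists lam : F -> bool,
    {morph lam : x y / (x + y)%R >-> x (+) y} /\ exists e, lam e.
Proof.
move=> charF; pose V : vectType 'F_2 := pPrimeCharType charF.
pose b := vbasis (fullv : {vspace V}).
pose f i (x : F) : 'F_2 := coord b i (x : V).
have [i fi1] : exists i, f i 1%R != 0%R.
  apply/existsP; apply: contraT => /existsPn f0.
  rewrite -(oner_eq0 F); apply/eqP.
  apply: etrans (coord_vbasis (memvf (1%R : V))) _; rewrite big1 // => i _.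
  by have := f0 i; rewrite negbK => /eqP; rewrite /f /b => ->; rewrite scale0r.
have F2E (a : 'F_2) : a = (a == 1%R)%:R%R.
  by apply/eqP; case: a => [[|[|m]] lt_m]; rewrite // -val_eqE.
exists (fun x => f i x == 1%R); split.
  move=> x y; have -> : f i (x + y)%R = (f i x + f i y)%R by exact: linearD.
  by rewrite [f i x]F2E [f i y]F2E; case: (f i x == 1%R); case: (f i y == 1%R).
by exists 1%R; move: fi1; rewrite [f i 1%R]F2E; case: (f i 1%R == 1%R).
Qed.

Section AdditiveCharacter.
Variables (F : finFieldType) (lam : F -> bool) (e : F).
Hypothesis lamD : {morph lam : x y / (x + y)%R >-> x (+) y}.
Hypothesis lame : lam e.

Lemma character0 : lam 0%R = false.
Proof. by have := lamD 0%R 0%R; rewrite addr0; case: lam. Qed.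

Lemma characterB : {morph lam : x y / (x - y)%R >-> x (+) y}.
Proof.
move=> x y; rewrite lamD; congr addb.
by have := lamD y (- y)%R; rewrite subrr character0; do 2!case: lam.
Qed.

(** The translation of [y] by [e / c] flips the value of [lam], so zeros and ones are equally
    many. *)
Lemma character_balanced (c d : F) : c != 0%R ->
  2 * \sum_y ~~ lam (c * y + d)%R = #|F|.
Proof.
move=> c0; rewrite mul2n -addnn.
rewrite [X in X + _](reindex_inj (addIr (e / c)%R)) /= -big_split /=.
rewrite -sum1_card; apply: eq_bigr => y _.
rewrite (_ : (_ * _ + d) = (c * y + d) + e)%R; last by field.
by rewrite [in X in X + _]lamD lame addbT negbK; case: lam.
Qed.

(** Each nonconstant map has [#|F| / 2] zeros; the at most one constant map may have [#|F|], whence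
    the extra 1. *)
Lemma character_affine_family (I : finType) (c d : I -> F) :
    (forall i j, c i = 0%R -> c j = 0%R -> i = j) ->
  2 * \sum_i \sum_y ~~ lam (c i * y + d i)%R <= #|I|.+1 * #|F|.
Proof.
move=> c_inj; rewrite big_distrr /=.
apply: (@leq_trans (\sum_i (#|F| + (c i == 0%R) * #|F|))).
  apply: leq_sum => i _; have [_|c0] := eqVneq (c i) 0%R; last first.
    by rewrite character_balanced // addn0.
  rewrite mul1n addnn -mul2n leq_mul2l /= -sum1_card.
  by apply: leq_sum => y _; case: lam.
rewrite big_split /= sum_nat_const -big_distrl /= -mulnDl leq_mul2r.
apply/orP; right; rewrite -addn1 leq_add2l.
rewrite (_ : \sum_i _ = #|[set i | c i == 0%R]%SET|).
  by apply/card_le1_eqP => i j; rewrite !inE => /eqP ci /eqP cj; apply: c_inj.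
rewrite -sum1_card [RHS]big_mkcond; apply: eq_bigr => i _.
by rewrite inE; case: eqP.
Qed.

End AdditiveCharacter.

(** * The graph built from a character *)

Lemma exists_Gr_character (F : finFieldType) (t k : nat) :
    2 \in [pchar F]%R -> t < #|F| -> 4 + t.+1 * #|F| < 2 * k ->
    k <= t * #|F| ->
  exists G, Gr (t * #|F|) k G.
Proof.
move=> charF lt_tq lt_k le_kn.
have [lam [lamD [e lame]]] := exists_pchar2_character charF.
pose s (i : 'I_t) : F := nth 0%R (enum [pred x : F | x != 0%R]) i.
have size_s : size (enum [pred x : F | x != 0%R]) = #|F|.-1.
  by rewrite -cardE -(cardC1 (0%R : F)); apply: eq_card => x; rewrite !inE.
have lt_s (i : 'I_t) : i < size (enum [pred x : F | x != 0%R]).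
  by rewrite size_s; have := ltn_ord i; lia.
have s_neq0 i : s i != 0%R.
  by have := mem_nth 0%R (lt_s i); rewrite mem_enum.
have s_inj : injective s.
  by move=> i j /eqP; rewrite nth_uniq ?enum_uniq // => /eqP/val_inj.
pose V : finType := ('I_t * F)%type.
pose f (u v : V) := (u.2 * v.2 + s u.1 * s v.1 * (u.2 + v.2))%R.
pose r (u v : V) := (u != v) && lam (f u v).
have r_sym : symmetric r.
  move=> u v; rewrite /r eq_sym; congr (_ && lam _); rewrite /f; ring.
have r_irr : irreflexive r by move=> u; rewrite /r eqxx.
pose G := SGraph r_sym r_irr; exists G.
apply/(Gr_word G le_kn); have cardG : #|G| = t * #|F|.
  by rewrite /= card_prod card_ord.
split=> // u v neq_uv.
(* The empty word gets parameters (0, 0): its affine maps vanish, and 0 is none of the [s i]. *)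
pose al (u : option G) : F := if u is Some z then s z.1 else 0%R.
pose be (u : option G) : F := if u is Some z then z.2 else 0%R.
(* On the block of i, [word w] is y |-> lam (c w i * y + d w i). *)
pose c u i : F := (be u + al u * s i)%R.
pose d u i : F := (al u * be u * s i)%R.
(* A closed neighbourhood contains its centre whatever [lam] says: one exceptional point per word,
   two per pair, hence the 4 in the doubled bound. *)
have wordE (w : option G) z :
    (z \in word w) = (Some z == w) || lam (c w z.1 * z.2 + d w z.1)%R.
  case: w => [x|] /=; last first.
    by rewrite inE /c /d /= !(mul0r, addr0) (character0 lamD).
  rewrite !inE (inj_eq Some_inj) /= /r (eq_sym x).
  case: eqVneq => //= _; congr lam; rewrite /f /c /d /=; ring.
rewrite hammingE cardG.
set A := finset _; suff ltA : #|A| < k by lia.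
have sum_eq (w : option G) : \sum_z (Some z == w) <= 1.
  case: w => [x|]; last by rewrite big1.
  by rewrite (bigD1 x) //= eqxx big1 // => z /negbTE; rewrite (inj_eq Some_inj) => ->.
pose cc i := (c u i - c v i)%R; pose dd i := (d u i - d v i)%R.
(* Subtracting two vanishing slopes forces [al u = al v], then [be u = be v], so [u = v]. *)
have cc_inj i j : cc i = 0%R -> cc j = 0%R -> i = j.
  rewrite /cc /c => ci cj; apply/eqP/negPn/negP => neq_ij.
  have : ((al u - al v) * (s i - s j) = 0)%R.
    by apply: etrans (etrans (congr2 (fun x y => x - y)%R ci cj) (subrr _)); ring.
  move/eqP; rewrite mulf_eq0 !subr_eq0 (inj_eq s_inj) (negbTE neq_ij) orbF.
  move=> /eqP eq_al; have eq_be : be u = be v.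
    by move: ci; rewrite eq_al => ci; apply: subr0_eq; rewrite -[RHS]ci; ring.
  move: neq_uv eq_al eq_be; rewrite /al /be.
  clear A cc dd ci cj; case: u v => [[a x]|] [[a' x']|] //=.
  - by move=> + /s_inj eq_a eq_x; rewrite eq_a eq_x eqxx.
  - by move=> _ /eqP; rewrite (negbTE (s_neq0 a)).
  - by move=> _ /esym/eqP; rewrite (negbTE (s_neq0 _)).
have := character_affine_family lamD lame dd cc_inj; rewrite card_ord pair_bigA /=.
set X := \sum_p _ => leX.
have : #|A| <= \sum_z (Some z == u) + \sum_z (Some z == v) + X.
  rewrite -sum1_card big_mkcond -!big_split /=; apply: leq_sum => z _.
  rewrite inE !wordE; set lu := lam _; set lv := lam _.
  rewrite (_ : lam _ = lu (+) lv); first by case: (Some z == u); case: (Some z == v); case: lu; case: lv.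
  by rewrite /lu /lv -(characterB lamD); congr lam; rewrite /cc /dd; ring.
move=> leA; apply: leq_ltn_trans leA _.
have := leq_ltn_trans (leq_add (leqnn 4) leX) lt_k.
have := sum_eq u; have := sum_eq v; lia.
Qed.

(** * Bounds on [Xi] and the limit *)

Lemma Xi_ge (n k : nat) (G : sgraph) : k <= n -> Gr n k G -> n <= Xi k.
Proof.
move=> le_kn GrG; rewrite /Xi; case: ex_maxnP => m _; apply.
by rewrite le_kn; apply/asboolP; exists G.
Qed.

Lemma Xi_le (k : nat) : 2 <= k -> Xi k <= 2 * k - 2.
Proof.
move=> k2; rewrite /Xi; case: ex_maxnP => m /andP[le_km /asboolP[G GrG]] _.
exact: Gr_le GrG.
Qed.

Lemma Xi_asymptotic_lower (k : nat) : 200 <= k ->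
  exists2 D, 2 * k <= Xi k + D & D ^ 2 <= 200 * k.
Proof.
(* With this [q], [4 * k < q ^ 2 <= 16 * k], so [6 + 2 * q] is of order sqrt k. *)
move=> k200; pose m := trunc_log 4 k; pose q := 2 ^ m.+2.
have /andP[lo hi] : 4 ^ m <= k < 4 ^ m.+1 by apply: trunc_log_bounds; lia.
have qE : q ^ 2 = 16 * 4 ^ m by rewrite /q -expnM [m.+2 * 2]mulnC expnM !expnS mulnA.
have [F charF cardF] := PrimePowerField (isT : prime 2) (isT : 0 < m.+2).
(* The largest [t] with [4 + t.+1 * q <= 2 * k - 2]; maximality gives
   [t * q > 2 * k - (6 + 2 * q)]. *)
pose t := ((k - 3) * 2) %/ q - 1.
have lo_q : q ^ 2 <= 16 * k by lia.
have hi_q : 4 * k < q ^ 2 by rewrite qE; move: hi; rewrite expnS; lia.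
have Dk : (6 + 2 * q) ^ 2 <= 200 * k by nia.
have le_Dk : 6 + 2 * q <= k by rewrite -leq_sqr; nia.
have q_gt0 : 0 < q by rewrite expn_gt0.
have t1 : 0 < ((k - 3) * 2) %/ q by rewrite divn_gt0 //; lia.
have tE : t.+1 = ((k - 3) * 2) %/ q by rewrite /t; lia.
have t_le : t.+1 * q <= (k - 3) * 2 by rewrite tE leq_divM.
have t_gt : (k - 3) * 2 < t.+2 * q by rewrite tE; apply: ltn_ceil.
have [G GrG] : exists G, Gr (t * q) k G.
  rewrite /q -cardF; apply: exists_Gr_character; rewrite ?cardF -/q //; nia.
exists (6 + 2 * q) => //.
have : t * q <= Xi k by apply: Xi_ge GrG; nia.
nia.
Qed.

Local Open Scope classical_set_scope.
Local Open Scope ring_scope.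

Theorem theorem4 (R : realType) :
  (forall k : nat, (2 <= k)%N -> (Xi k <= 2 * k - 2)%N) /\
  (((Xi k)%:R / k%:R : R) @[k --> \oo] --> (2 : R)).
Proof.
split; first exact: Xi_le.
apply/cvgrPdist_le => eps eps0; near=> k.
have k200 : (200 <= k)%N by near: k; exact: nbhs_infty_ge.
have [D le_D D2] := Xi_asymptotic_lower k200.
have le_Xi : (Xi k <= 2 * k)%N by have := @Xi_le k; lia.
have k_gt0 : 0 < k%:R :> R by rewrite ltr0n; lia.
(* For [k >= 200 / eps ^ 2], [D ^ 2 <= 200 * k] yields [D <= eps * k]. *)
have le_eps : 200%:R <= eps ^+ 2 * k%:R.
  rewrite mulrC -ler_pdivrMr ?exprn_gt0 //.
  by near: k; exact: nbhs_infty_ger.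
have le_XiR : (Xi k)%:R <= 2 * k%:R :> R by rewrite -natrM ler_nat.
have le_DR : 2 * k%:R <= (Xi k)%:R + D%:R :> R by rewrite -natrM -natrD ler_nat.
have D2R : D%:R ^+ 2 <= 200%:R * k%:R :> R by rewrite -natrX -natrM ler_nat.
have D_le : D%:R <= eps * k%:R.
  rewrite -ler_sqr ?nnegrE ?ler0n ?mulr_ge0 ?(ltW eps0) ?ler0n // exprMn.
  by apply: le_trans D2R _; rewrite (expr2 k%:R) mulrA ler_pM2r.
have -> : 2 - (Xi k)%:R / k%:R = (2 * k%:R - (Xi k)%:R) / k%:R :> R.
  by rewrite mulrBl mulfK // gt_eqF.
rewrite ger0_norm ?divr_ge0 ?subr_ge0 ?ler0n // ler_pdivrMr //.
by rewrite lerBlDl; apply: le_trans le_DR _; rewrite lerD2l.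
Unshelve. all: by end_near.
Qed.
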